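(* Let $X$ be a real Banach space and let $\tau$ denote either the norm topology or the weak topology on $X$. Let $Y$ be a finite dimensional subspace of $X$ and let $Z$ be a closed linear subspace of $X$ such that $(X,Z,\mathcal{F}(X))$ has $\tau$-$\mathscr{F}_{cmc}$-property-$(P_1)$. Then $(X,Y+Z,\mathcal{F}(X))$ has $\tau$-$\mathscr{F}_{cmc}$-property-$(P_1)$.
   Context: All Banach spaces are real. $\mathcal{F}(X)$ is the set of all nonempty finite subsets of $X$. $\mathscr{F}_{cmc}$ is the class of all functions $f:\mathbb{R}^N_+\to\mathbb{R}_+$, $N\in\mathbb{N}$, that are convex, monotone ($\varphi_1\le\varphi_2$ coordinatewise implies $f(\varphi_1)\le f(\varphi_2)$) and coercive ($f(\varphi)\to\infty$ as $\|\varphi\|_\infty\to\infty$). For $x\in X$, a $\tau$-closed subset $V\subseteq X$, $F=\{x_1,\dots,x_N\}\in\mathcal{F}(X)$, $f:\mathbb{R}^N_+\to\mathbb{R}_+$ and $\delta>0$: $r_f(x,F)=f(\|x-x_1\|,\dots,\|x-x_N\|)$, $\mathrm{rad}_V^f(F)=\inf_{v\in V}r_f(v,F)$, $\mathrm{Cent}_V^f(F)=\{v\in V:r_f(v,F)=\mathrm{rad}_V^f(F)\}$, $\delta\text{-}\mathrm{Cent}_V^f(F)=\{v\in V:r_f(v,F)\le\mathrm{rad}_V^f(F)+\delta\}$. The triplet $(X,V,\mathcal{F}(X))$ has $\mathscr{F}_{cmc}$-rcp if $\mathrm{Cent}_V^f(F)\neq\emptyset$ for all $F=\{x_1,\dots,x_N\}\in\mathcal{F}(X)$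 and all $f:\mathbb{R}^N_+\to\mathbb{R}_+$ in $\mathscr{F}_{cmc}$. It has $\tau$-$\mathscr{F}_{cmc}$-property-$(P_1)$ if it has $\mathscr{F}_{cmc}$-rcp and for every $F=\{x_1,\dots,x_N\}\in\mathcal{F}(X)$, every $f:\mathbb{R}^N_+\to\mathbb{R}_+$ in $\mathscr{F}_{cmc}$ and every $\tau$-neighborhood $W$ of $0$ there exists $\delta>0$ such that $\delta\text{-}\mathrm{Cent}_V^f(F)\subseteq\mathrm{Cent}_V^f(F)+W$. *)

(* Defs.v *)
From HB Require Import structures.
From mathcomp Require Import all_boot all_order all_algebra.
From mathcomp Require Import all_classical all_reals all_analysis.
Set Implicit Arguments.
Unset Strict Implicit.
Unset Printing Implicit Defensive.
Import Order.TTheory GRing.Theory Num.Theory.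
Import numFieldNormedType.Exports.
Local Open Scope classical_set_scope.
Local Open Scope ring_scope.

Section Topologies.
Variables (R : realType) (X : completeNormedModType R).

Definition dual := {phi : {scalar X} | continuous (phi : X -> R)}.

(* Initial topology of X with respect to all continuous linear functionals. *)
Definition weak_space : topologicalType :=
  sup_topology (fun phi : dual =>
    Topological.class (initial_topology (sval phi : X -> R))).

Inductive topology_choice := NormTopology | WeakTopology.

Definition tau_closed (tau : topology_choice) (V : set X) : Prop :=
  match tau with
  | NormTopology => closed V
  | WeakTopology => @closed weak_space V
  end.

Definition tau_nbhs (tau : topology_choice) (x : X) : set_system X :=
  match tau with
  | NormTopology => nbhs x
  | WeakTopology => @nbhs _ weak_space x
  end.

End Topologies.

Section Fcmc.
Variables (R : realType) (N : nat).
Implicit Types f : 'rV[R]_N -> R.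

Definition orthant : set 'rV[R]_N := [set a | forall i, 0 <= a ord0 i].

(* A function R^N_+ -> R_+ is represented by a function on R^N of which only
   the restriction to the orthant matters; `|a| is the sup norm of a. *)
Definition Fcmc f : Prop :=
  [/\ forall a, orthant a -> 0 <= f a,
      convex_function orthant f,
      forall a b, orthant a -> orthant b ->
        (forall i, a ord0 i <= b ord0 i) -> f a <= f b &
      forall M : R, exists K : R,
        forall a, orthant a -> K <= `|a| -> M <= f a].

End Fcmc.

(* A finite set F = {x_1, ..., x_N} is given by an enumeration F : 'I_N -> X;
   the properties below quantify over all N > 0 and all injective F, that is
   over all nonempty finite sets and all orderings of their N elements. *)
Section Centers.
Variables (R : realType) (X : completeNormedModType R).
Variables (N : nat) (f : 'rV[R]_N -> R) (V : set X) (F : 'I_N -> X).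

Definition r_f (x : X) : R := f (\row_i `|x - F i|).

Definition rad : R := inf [set r_f v | v in V].

Definition Cent : set X := [set v | V v /\ r_f v = rad].

Definition delta_Cent (delta : R) : set X :=
  [set v | V v /\ r_f v <= rad + delta].

End Centers.

Section Properties.
Variables (R : realType) (X : completeNormedModType R).

Definition set_sum (A B : set X) : set X := [set a + b | a in A & b in B].

Definition Fcmc_rcp (V : set X) : Prop :=
  forall (N : nat) (F : 'I_N -> X) (f : 'rV[R]_N -> R),
    (0 < N)%N -> injective F -> Fcmc f -> Cent f V F !=set0.

(* The property only makes sense for tau-closed V, hence the first clause. *)
Definition Fcmc_property_P1 (tau : topology_choice) (V : set X) : Prop :=
  [/\ tau_closed tau V,
      Fcmc_rcp V &
      forall (N : nat) (F : 'I_N -> X) (f : 'rV[R]_N -> R) (W : set X),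
        (0 < N)%N -> injective F -> Fcmc f -> tau_nbhs tau 0 W ->
        exists2 delta : R, 0 < delta &
          delta_Cent f V F delta `<=` set_sum (Cent f V F) W].

Definition linear_subspace (V : set X) : Prop := submod_closed [in V].

Definition finite_dim_subspace (Y : set X) : Prop :=
  linear_subspace Y /\
  exists (n : nat) (e : 'I_n -> X),
    Y = [set \sum_(i < n) a ord0 i *: e i | a in [set: 'rV[R]_n]].

End Properties.

(* Main.v *)
(* Adjoin one vector [e] at a time.  If [Z] is closed and [e] is not in [Z],
   then [|t|] is controlled by the norm of [t e + z], so by coercivity the
   almost optimal points of [V = R e + Z] lie on slices [t e + Z] with [t] in a
   compact interval.  Up to translation, the problem on a slice is the problem
   for [Z] and the set [F - t e], for which (P1) holds; and a function of the
   class F_cmc is uniformly continuous on bounded sets, so what holds on one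
   slice persists on the neighbouring ones.  Compactness of the interval then
   yields a single delta for all slices.  The same inclusion, for the trivial
   neighbourhood, shows that the set of centers of [V] is nonempty. *)
Require Import Defs.
From mathcomp Require Import all_boot all_order all_algebra.
From mathcomp Require Import all_classical all_reals all_analysis.
From mathcomp Require Import lra.
Import numFieldNormedType.Exports.
Import Order.TTheory GRing.Theory Num.Theory.
Local Open Scope classical_set_scope.
Local Open Scope ring_scope.

(** * Affine maps in the two topologies, and the subspace [R e + Z] *)

Section Topology.
Context {R : realType} {X : completeNormedModType R}.
Implicit Types (tau : topology_choice) (Z : set X).

#[global] Instance tau_nbhs_filter tau (x : X) : Filter (tau_nbhs tau x).
Proof.
case: tau; rewrite /tau_nbhs.
  exact: nbhs_filter.
exact: (@nbhs_filter (weak_space X)).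
Qed.

Lemma tau_closedP tau (V : set X) :
  tau_closed tau V <-> forall x, ~ V x -> tau_nbhs tau x (~` V).
Proof.
by case: tau; rewrite /tau_closed -openC openE.
Qed.

Lemma weak_continuous (phi : dual X) :
  continuous (sval phi : weak_space X -> R).
Proof.
move=> x A /(@initial_continuous _ _ (sval phi : X -> R) x).
have /cvg_sup : nbhs (x : weak_space X) --> (x : weak_space X) by [].
by move=> /(_ phi); apply.
Qed.

(** Joint continuity in both scalars and the vector; through it the later arguments treat both
    topologies at once. *)
Lemma tau_affine_near tau (u s : R) (x e : X) (W : set X) :
  tau_nbhs tau (u *: x + s *: e) W ->
  \forall p \near (nbhs u, nbhs s) & y \near tau_nbhs tau x,
    W (p.1 *: y + p.2 *: e).
Proof.
set G := filter_prod (filter_prod (nbhs u) (nbhs s)) (tau_nbhs tau x).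
suff: (fun q : R * R * X => q.1.1 *: q.2 + q.1.2 *: e) @ G
    --> tau_nbhs tau (u *: x + s *: e).
  by move=> /[apply].
have Gu : (fun q : R * R * X => q.1.1) @ G --> u.
  exact: (cvg_comp _ _ cvg_fst cvg_fst).
have Gs : (fun q : R * R * X => q.1.2) @ G --> s.
  exact: (cvg_comp _ _ cvg_fst cvg_snd).
have Gx : (fun q : R * R * X => q.2) @ G --> tau_nbhs tau x by exact: cvg_snd.
case: tau @G Gu Gs Gx => G Gu Gs Gx /=.
  by apply: cvgD; [apply: cvgZ|apply: cvgZr_tmp].
(* Weak convergence is tested on each functional [phi], where it becomes convergence in [R]. *)
apply/cvg_sup => phi U [B [[A oA <-] At] sU].
apply: (filterS sU).
have phiE q : sval phi (q.1.1 *: q.2 + q.1.2 *: e : X)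
    = q.1.1 * sval phi (q.2 : X) + q.1.2 * sval phi e.
  by rewrite linearD !linearZ.
suff: (fun q : R * R * X => sval phi (q.1.1 *: q.2 + q.1.2 *: e)) @ G
    --> sval phi (u *: x + s *: e).
  by apply; exact: open_nbhs_nbhs.
rewrite (_ : (fun q => _) = fun q : R * R * X => 
   q.1.1 * sval phi (q.2 : X) + q.1.2 * sval phi e); last exact/funext.
rewrite linearD !linearZ.
apply: cvgD; apply: cvgM => //; last exact: cvg_cst.
exact: (cvg_comp _ _ Gx (weak_continuous phi x)).
Qed.

Lemma subspaceP Z : linear_subspace Z ->
  Z 0 /\ forall a u v, Z u -> Z v -> Z (a *: u + v).
Proof.
move=> [Z0 ZD]; split; first by move: Z0; rewrite inE.
by move=> a u v Zu Zv; have := ZD a u v; rewrite !inE; apply.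
Qed.

(** This is [R e + Z], described as the union of the slices [t e + Z]. *)
Definition adjoin (e : X) Z : set X := [set x | exists t, Z (x - t *: e)].

Lemma subset_adjoin e Z : Z `<=` adjoin e Z.
Proof. by move=> x Zx; exists 0; rewrite scale0r subr0. Qed.

Lemma adjoin_id e Z : linear_subspace Z -> Z e -> adjoin e Z = Z.
Proof.
move=> /subspaceP[Z0 ZD] Ze; rewrite eqEsubset; split; last exact: subset_adjoin.
by move=> x [t Zx]; have := ZD t _ _ Ze Zx; rewrite addrC subrK.
Qed.

Lemma adjoin_subspace e Z : linear_subspace Z -> linear_subspace (adjoin e Z).
Proof.
move=> /subspaceP[Z0 ZD]; split; first by rewrite inE; exact: subset_adjoin.
move=> a u v; rewrite !inE => -[t Zu] [s Zv]; exists (a * t + s).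
have := ZD a _ _ Zu Zv.
by rewrite scalerBr addrACA -opprD scalerA -scalerDl.
Qed.

(** Scaling by [- t^-1] turns a point of the slice at [t] into a point of [Z] that is close to [e]
    when [t] is large compared with [x]. *)
Lemma subspace_div e Z (t : R) x : linear_subspace Z -> t != 0 ->
  Z (x - t *: e) -> Z (- t^-1 *: x + e).
Proof.
move=> /subspaceP[Z0 ZD] t0 /(ZD (- t^-1) _ 0)/(_ Z0).
by rewrite addr0 scalerBr !scaleNr opprK scalerA mulVf// scale1r.
Qed.

(* Compactness of an interval handles the bounded multiples of [e]; the large
   ones are excluded since [y - t e] in [Z] means [e - y / t] in [Z]. *)
Lemma tau_closed_adjoin tau e Z : linear_subspace Z -> ~ Z e ->
  tau_closed tau Z -> tau_closed tau (adjoin e Z).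
Proof.
move=> lZ Ze /tau_closedP cZ; apply/tau_closedP => x Vx.
(* With [e] written as [0 x + 1 e], the points [u y + s e] avoid [Z] for [u] near 0, [s] near 1 and
   [y] near [x]. *)
have := cZ e Ze; rewrite -[e in tau_nbhs _ e](add0r e) -(scale0r x).
rewrite -[e in _ + e]scale1r => /tau_affine_near.
move=> [[U G] /= [[[U1 U2] /= [U10 U21] U12] xG] UG].
have /nbhs_ballP[d /= d0 dU1] := U10.
(* If [t] exceeds this bound in absolute value, then [- t^-1] lies in the ball of radius [d] about
   0, hence in [U1]. *)
pose M := d^-1 + 1.
have /compact_near_coveringP covM := @segment_compact _ (- M) M.
have bounded : \forall y \near tau_nbhs tau x,
    `[- M, M] `<=` (fun t => ~ Z (y - t *: e)).
  apply: covM => t _.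
  have /cZ : ~ Z (x - t *: e) by move=> Zx; apply: Vx; exists t.
  rewrite -[x in tau_nbhs _ (x - _)]scale1r -scaleNr => /tau_affine_near.
  move=> [[A B] /= [[[A1 A2] /= [A11 A2t] A12] xB] AB].
  exists ([set s | A2 (- s)], B) => /=.
    split => //; have := @oppr_continuous R R t A2. exact.
  move=> [s y] /= [A2s By]; rewrite -[y]scale1r -scaleNr.
  apply: (AB ((1, - s), y)); split => //=.
  by apply: A12; split => //=; exact: nbhs_singleton.
apply: filterS2 xG bounded => y Gy My [t Zyt].
have [tM|Mt] := leP `|t| M.
  by apply: (My t) => //=; rewrite in_itv/= -ler_norml.
have M0 : 0 < M by rewrite addr_gt0 ?invr_gt0.
have t0 : t != 0 by rewrite -normr_gt0; exact: lt_trans Mt.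
apply: (UG ((- t^-1, 1), y)); last by rewrite /= scale1r; exact: subspace_div.
split => //=; apply: U12; split => /=; last exact: nbhs_singleton.
apply: dU1; rewrite /ball/= sub0r opprK normfV.
rewrite invf_plt ?posrE//; last exact: lt_trans Mt.
by apply: lt_trans Mt; rewrite ltrDl.
Qed.

(** Some ball of radius [rho] about [e] misses [Z], whereas [e - x / t] lies in [Z]; so [x / t] has
    norm at least [rho]. *)
Lemma adjoin_norm_ge e Z : linear_subspace Z -> ~ Z e -> closed Z ->
  exists2 rho : R, 0 < rho &
    forall t x, Z (x - t *: e) -> rho * `|t| <= `|x|.
Proof.
move=> lZ Ze /(@tau_closedP NormTopology)/(_ e Ze)/nbhs_ballP[rho rho0 eZ].
exists rho => // t x Zx; rewrite leNgt; apply/negP => xt.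
have t0 : t != 0.
  by apply: contraTneq xt => ->; rewrite normr0 mulr0 -leNgt.
apply: eZ (subspace_div _ _ _ _ lZ t0 Zx); rewrite -ball_normE/=.
by rewrite opprD addrCA subrr addr0 scaleNr opprK normrZ normfV mulrC
  ltr_pdivrMr ?normr_gt0.
Qed.

End Topology.

(** * Boundedness and uniform continuity of [r_f] on its sublevel sets *)

Section Radius.
Context {R : realType} {N : nat}.
Implicit Types f : 'rV[R]_N -> R.

Lemma norm_coord_le (a : 'rV[R]_N) i : `|a ord0 i| <= `|a|.
Proof.
rewrite [leRHS]/Num.norm /= mx_normrE; apply/bigmax_geP; right => /=.
by exists (ord0, i).
Qed.

(* [a + eta] is the convex combination of [a] and [a + 1] with weights
   [1 - eta] and [eta]. *)
Lemma Fcmc_shift f (K eps : R) : Fcmc f -> 0 < eps ->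
  exists2 eta : R, 0 < eta & forall a b, orthant a -> orthant b ->
    (forall i, a ord0 i <= K) -> (forall i, b ord0 i <= a ord0 i + eta) ->
    f b <= f a + eps.
Proof.
move=> [f0 fconv fmono _] eps0.
(* By monotonicity [C] bounds [f (a + 1)] whenever the coordinates of [a] are at most [K]; below,
   [C + 1] serves as a positive denominator. *)
pose C := f (const_mx (`|K| + 1)).
have C0 : 0 <= C by apply: f0 => i; rewrite mxE addr_ge0.
pose eta := Num.min 1 (eps / (C + 1)).
have eta0 : 0 < eta by rewrite lt_min ltr01 divr_gt0// ltr_wpDl.
have eta1 : eta <= 1 by rewrite ge_min lexx.
have etaC : eta * C <= eps.
  apply: (@le_trans _ _ (eta * (C + 1))); first by rewrite ler_pM2l// lerDl.
  by rewrite -ler_pdivlMr ?ltr_wpDl// ge_min lexx orbT.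
exists eta => // a b oa ob aK ba.
have oa1 : orthant (a + const_mx 1) by move=> i; rewrite !mxE addr_ge0.
have oae : orthant (a + const_mx eta).
  by move=> i; rewrite !mxE addr_ge0// ltW.
apply: (@le_trans _ _ (f (a + const_mx eta))).
  by apply: fmono => // i; rewrite !mxE.
have -> : a + const_mx eta = eta *: (a + const_mx 1) + (1 - eta) *: a.
  by apply/rowP => i; rewrite !mxE; lra.
have := fconv (Itv01 (ltW eta0) eta1) (a + const_mx 1) a.
rewrite !inE => /(_ oa1 oa) fle.
have fC : f (a + const_mx 1) <= C.
  apply: fmono => // [i|i]; rewrite !mxE ?addr_ge0//.
  by rewrite lerD2r (le_trans (aK i))// ler_norm.
apply: (@le_trans _ _ (eta * f (a + const_mx 1) + (1 - eta) * f a) _ _ fle).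
by have := ler_wpM2l (ltW eta0) fC; have := mulr_ge0 (ltW eta0) (f0 _ oa); lra.
Qed.

Context {X : completeNormedModType R}.
Implicit Types (F : 'I_N -> X) (V : set X).

Lemma orthant_dist F x : orthant (\row_i `|x - F i|).
Proof. by move=> i; rewrite mxE. Qed.

Lemma r_fD f F x y : r_f f F (x + y) = r_f f (fun i => F i - y) x.
Proof.
by congr f; apply/rowP => i; rewrite !mxE opprB addrA.
Qed.

(** Coercivity bounds the vector of distances, and its first coordinate alone bounds [x]. *)
Lemma r_f_bounded f F (B : R) : (0 < N)%N -> Fcmc f ->
  exists K, forall x, r_f f F x <= B -> `|x| <= K.
Proof.
move=> N0 [_ _ _ /(_ (B + 1))[K fK]].
pose i0 := Ordinal N0; exists (K + `|F i0|) => x xB.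
have lK : `|\row_i `|x - F i| | <= K.
  rewrite leNgt; apply/negP => /ltW/(fK _ (orthant_dist F x)).
  by apply/negP; rewrite -ltNge (le_lt_trans xB)// ltrDl.
rewrite -[x](subrK (F i0)) (le_trans (ler_normD _ _))// lerD2r.
apply: le_trans lK; apply: le_trans (norm_coord_le _ i0).
by rewrite mxE normr_id.
Qed.

(** On a sublevel set all distances to [F] are bounded by one constant, and moving [x] by at most
    [eta] changes each of them by at most [eta]; [Fcmc_shift] then applies. *)
Lemma r_f_shift f F (B eps : R) : (0 < N)%N -> Fcmc f -> 0 < eps ->
  exists2 eta : R, 0 < eta & forall x y, `|x - y| <= eta ->
    r_f f F x <= B -> r_f f F y <= r_f f F x + eps.
Proof.
move=> N0 ff eps0; have [K xK] := r_f_bounded f F B N0 ff.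
pose D := \sum_i `|F i|.
have [eta eta0 fe] := Fcmc_shift f (K + D) eps ff eps0.
exists eta => // x y xy /xK xleK; apply: fe => [||i|i]; try exact: orthant_dist.
- rewrite mxE (le_trans (ler_normB _ _))// lerD//.
  by rewrite /D (bigD1 i)//= lerDl sumr_ge0.
- rewrite !mxE (_ : y - F i = (x - F i) + (y - x)).
    by rewrite (le_trans (ler_normD _ _))// lerD2l distrC.
  by rewrite [RHS]addrC addrA subrK.
Qed.

Lemma r_f_lbound f F V : Fcmc f -> has_lbound [set r_f f F v | v in V].
Proof. by move=> [f0 _ _ _]; exists 0 => _ [v _ <-]; exact/f0/orthant_dist. Qed.

Lemma rad_le f F V v : Fcmc f -> V v -> Defs.rad f V F <= r_f f F v.
Proof. by move=> ff Vv; apply: ge_inf; [exact: r_f_lbound|exists v]. Qed.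

Lemma delta_Cent_neq0 f F V (delta : R) : Fcmc f -> V !=set0 -> 0 < delta ->
  delta_Cent f V F delta !=set0.
Proof.
move=> ff [v0 Vv0] d0.
have [|_ [v Vv <-] vd] := @inf_adherent _ [set r_f f F v | v in V] _ d0.
  by split; [exists (r_f f F v0), v0|exact: r_f_lbound].
by exists v; split => //; exact: ltW.
Qed.

End Radius.

(** * Property (P1) for [R e + Z] *)

Section Adjoin.
Context {R : realType} {X : completeNormedModType R}.
Variables (tau : topology_choice) (e : X) (Z : set X).
Hypotheses (lZ : linear_subspace Z) (cZ : closed Z) (Ze : ~ Z e).
Hypothesis ZP1 : Fcmc_property_P1 tau Z.

Let V := adjoin e Z.

Section Inclusion.
Variables (N : nat) (f : 'rV[R]_N -> R) (F : 'I_N -> X) (W : set X).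
Hypotheses (N0 : (0 < N)%N) (injF : injective F) (ff : Fcmc f).
Hypothesis W0 : tau_nbhs tau 0 W.

Let good (delta t : R) := forall x, Z (x - t *: e) ->
  r_f f F x <= Defs.rad f V F + delta -> set_sum (Cent f V F) W x.

(* If the best approximation on the slice [t e + Z] is optimal in [V], apply
   (P1) for [Z] to the translate [F - t e]; otherwise no slice near [t e + Z]
   contains an almost optimal point. *)
Lemma adjoin_delta_Cent_local (t : R) :
  \forall s \near t & delta \near (0 : R)^'+, good delta s.
Proof.
have [_ rcpZ P1Z] := ZP1.
pose G i := F i - t *: e.
have injG : injective G by move=> i j /addIr/injF.
have GF x : r_f f G x = r_f f F (x + t *: e) by rewrite r_fD.
have ZV x : Z x -> V (x + t *: e) by move=> Zx; exists t; rewrite addrK.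
have [c [Zc cG]] := rcpZ _ _ _ N0 injG ff.
(* A point [x] of the slice at [s] is compared with [x - (s - t) e] in the slice at [t]. The bound
   is first assumed for the moved point; the cost of the move is paid afterwards. *)
have [delta0 delta00 inW] : exists2 delta0, 0 < delta0 &
    \forall s \near t, forall x, Z (x - s *: e) ->
      r_f f F (x - (s - t) *: e) <= Defs.rad f V F + delta0 ->
      set_sum (Cent f V F) W x.
  have := rad_le f F V _ ff (ZV _ Zc).
  rewrite -GF cG le_eqVlt => /orP[/eqP VG|VG].
    (* [W] must absorb both the error [w] from (P1) for [Z] and the displacement [(s - t) e]. *)
    have : tau_nbhs tau (1 *: 0 + 0 *: e) W by rewrite scaler0 scale0r addr0.
    move=> /tau_affine_near[[A B] /= [[[A1 A2] /= [A11 A20] A12] B0] ABW].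
    have [delta0 delta00 sub] := P1Z _ _ _ _ N0 injG ff B0.
    exists delta0 => //.
    have : \forall s \near t, A2 (s - t).
      have : (s - t) @[s --> t] --> t - t by apply: cvgB => //; exact: cvg_cst.
      by rewrite subrr => /(_ _ A20).
    apply: filterS => s A2s x Zx xV.
    have [|c' [Zc' c'G] [w Bw xE]] := sub (x - s *: e).
      split=> //; rewrite GF -VG; apply: le_trans xV.
      by rewrite scalerBl opprB addrA addrAC.
    exists (c' + t *: e).
      by split; [exact: ZV | rewrite -GF c'G].
    exists (w + (s - t) *: e).
      rewrite -[w]scale1r; apply: (ABW ((1, s - t), w)); split => //=.
      by apply: A12; split => //=; exact: nbhs_singleton.
    by rewrite addrACA xE scalerBl [t *: e + _]addrC !subrK.
  (* With half the gap between the two radii as tolerance, no moved point qualifies. *)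
  exists ((Defs.rad f Z G - Defs.rad f V F) / 2).
    by rewrite divr_gt0// subr_gt0.
  apply: filterE => s x Zx xV; exfalso.
  have := rad_le f G Z _ ff Zx.
  rewrite GF (_ : x - s *: e + t *: e = x - (s - t) *: e).
    by move: xV; lra.
  by rewrite scalerBl opprB addrA addrAC.
(* One half of [delta0] pays for the move and the other bounds [delta]; also [delta <= 1] keeps [x]
   in the sublevel set where [shift] is valid. *)
have d2 : 0 < delta0 / 2 by rewrite divr_gt0.
have [eta eta0 shift] := r_f_shift f F (Defs.rad f V F + 1) _ N0 ff d2.
near=> s delta => /= x Zx xV; apply: (near inW s) => //.
apply: (@le_trans _ _ (r_f f F x + delta0 / 2)).
  apply: shift.
    rewrite opprD addrA subrr sub0r opprK.
    near: s.
    have : `|(s - t) *: e| @[s --> t] --> `|(t - t) *: e|.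
      by apply: cvg_norm; apply: cvgZr_tmp; apply: cvgB => //; exact: cvg_cst.
    rewrite subrr scale0r normr0 => /cvgr_lt/(_ _ eta0).
    by apply: filterS => s; exact: ltW.
  apply: le_trans xV _; rewrite lerD2l.
  by near: delta; exact: nbhs_right_le.
rewrite [X in Defs.rad f V F + X](splitr delta0) addrA lerD2r.
apply: le_trans xV _; rewrite lerD2l.
by near: delta; exact: nbhs_right_le.
Unshelve. all: by end_near. Qed.

Lemma adjoin_delta_Cent : exists2 delta : R, 0 < delta &
  delta_Cent f V F delta `<=` set_sum (Cent f V F) W.
Proof.
have [rho rho0 eZ] := adjoin_norm_ge e Z lZ Ze cZ.
have [K xK] := r_f_bounded f F (Defs.rad f V F + 1) N0 ff.
(* For [delta <= 1] an almost optimal [x] has norm at most [K], so its slice parameter is at most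
   [K / rho] in absolute value. *)
pose M := K / rho.
have /compact_near_coveringP cov := @segment_compact _ (- M) M.
have near_good : \forall delta \near (0 : R)^'+, `[- M, M] `<=` good delta.
  by apply: cov => t _; exact: adjoin_delta_Cent_local.
have [delta [delta0 [delta1 dgood]]] : exists delta : R,
    0 < delta /\ delta <= 1 /\ `[- M, M] `<=` good delta.
  near ((0 : R)^'+) => delta; exists delta; split; [|split]; near: delta => //.
  - exact: nbhs_right_gt.
  - exact: nbhs_right_le.
exists delta => // x [[t Zx] xV].
apply: (dgood t) => //=; rewrite in_itv/= -ler_norml ler_pdivlMr// mulrC.
apply: le_trans (eZ _ _ Zx) _; apply: xK; apply: le_trans xV _.
by rewrite lerD2l.
Unshelve. all: by end_near. Qed.

End Inclusion.

Lemma adjoin_P1 : Fcmc_property_P1 tau V.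
Proof.
have [tZ _ _] := ZP1.
split; first exact: tau_closed_adjoin.
- move=> N F f N0 injF ff.
  have WT : tau_nbhs tau 0 [set: X] by exact: filterT.
  have [delta delta0 sub] := adjoin_delta_Cent _ _ _ _ N0 injF ff WT.
  have [|x /sub[c Vc _]] := delta_Cent_neq0 f F V delta ff _ delta0.
    by exists 0; apply: subset_adjoin; have [] := subspaceP _ lZ.
  by exists c.
- by move=> N F f W; exact: adjoin_delta_Cent.
Qed.

End Adjoin.

(** * Induction on the number of spanning vectors of [Y] *)

Theorem theorem3p9 (R : realType) (X : completeNormedModType R)
    (tau : topology_choice) (Y Z : set X) :
  finite_dim_subspace Y ->
  linear_subspace Z ->
  closed Z ->
  Fcmc_property_P1 tau Z ->
  Fcmc_property_P1 tau (set_sum Y Z).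
Proof.
move=> [_ [n [e ->]]] {Y}.
(* [Z] is generalized because the last vector is absorbed into it, leaving [n] vectors and the
   larger subspace [Z1]. *)
elim: n e Z => [|n IHn] e Z lZ cZ ZP1.
  rewrite (_ : set_sum _ Z = Z)//; rewrite eqEsubset; split => x.
    by move=> [_ [a _ <-] [z Zz <-]]; rewrite big_ord0 add0r.
  move=> Zx; exists 0; last by exists x; rewrite ?add0r.
  by exists 0 => //; rewrite big_ord0.
pose Z1 := adjoin (e ord_max) Z.
have -> : set_sum [set \sum_(i < n.+1) a ord0 i *: e i | a in [set: 'rV_n.+1]] Z
    = set_sum [set \sum_(i < n) a ord0 i *: e (widen_ord (leqnSn n) i)
              | a in [set: 'rV_n]] Z1.
  rewrite eqEsubset; split => x [_ [a _ <-] [z zZ <-]].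
    exists (\sum_(i < n) a ord0 (widen_ord (leqnSn n) i)
        *: e (widen_ord (leqnSn n) i)).
      exists (\row_i a ord0 (widen_ord (leqnSn n) i)) => //.
      by apply: eq_bigr => i _; rewrite mxE.
    exists (a ord0 ord_max *: e ord_max + z).
      by exists (a ord0 ord_max); rewrite addrAC subrr add0r.
    by rewrite big_ord_recr/= addrA.
  have [t Zt] := zZ.
  pose b : 'rV_n.+1 := \row_i (if unlift ord_max i is Some j then a ord0 j else t).
  exists (\sum_(i < n.+1) b ord0 i *: e i); first by exists b.
  exists (z - t *: e ord_max) => //.
  rewrite big_ord_recr/= mxE unlift_none -addrA [t *: _ + _]addrC subrK; congr (_ + _).
  apply: eq_bigr => i _; rewrite mxE.
  have -> : widen_ord (leqnSn n) i = lift ord_max i.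
    by apply: val_inj; rewrite /= /bump leqNgt ltn_ord.
  by rewrite liftK.
(* The spanning family may be dependent, so the last vector may already lie in [Z]; then [Z1] equals
   [Z]. *)
have [Ze|Ze] := pselect (Z (e ord_max)).
  by rewrite /Z1 adjoin_id//; exact: IHn.
apply: IHn.
- exact: adjoin_subspace.
- exact: (@tau_closed_adjoin _ _ NormTopology).
- exact: adjoin_P1.
Qed.
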